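(* For every classical noncrossing partition $\pi$ for $C_n$ there exists a unique classical nonnesting partition $\pi'$ for $C_n$ with $a(\pi')=a(\pi)$, $\mu(\pi')=\mu(\pi)$, $\nu(\pi')=\nu(\pi)$; for every classical nonnesting partition $\pi'$ for $C_n$ there exists a unique classical noncrossing partition $\pi$ for $C_n$ with these equalities; and any two such partitions $\pi,\pi'$ have the same type.
   Context: Let $\Lambda=\{1,\dots,n,-1,\dots,-n,0\}$. For a subspace $L\subseteq\mathbb R^n$ that is an intersection of (possibly zero) hyperplanes of the forms $x_i=x_j$, $x_i=-x_j$ ($i\ne j$), $x_i=0$, let $\mathrm{Part}(L)$ be the partition of $\Lambda$ in which, writing $x_{-i}:=-x_i$ and $x_0:=0$, elements $s,t$ lie in the same block iff $x_s=x_t$ for all $x\in L$. The partitions $\mathrm{Part}(L)$ are the classical partitions for $C_n$. The block containing $0$ is the zero block. The type of $\mathrm{Part}(L)$ is the orbit of $L$ under the group of all signed permutations of coordinates of $\mathbb R^n$. Bump diagram edges: for a partition $P$ and a total order $<$ on a ground set (elements not in the ground set, such as $0$, are ignored), $G(P)$ has an edge $(s,s')$ when $s<s'$ are in the same block with no element of that block strictly between. $P$ is noncrossing w.r.t. $<$ if there are no edges $(a,c),(b,d)$ with $a<b<c<d$; nonnesting if no edges $(a,d),(b,c)$ with $a<b<c<d$. A classical nonnesting partition for $C_n$ is a classical partition nonnesting w.r.t. $-n<\dots<-1<1<\dots<n$; a classical noncrossing partition for $C_n$ is one noncrossing w.r.t. $-1<-2<\dots<-n<1<2<\dots<n$. Statistics: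 a block is switching if it contains a positive element and a nonpositive element ($0$ counts as nonpositive); a positive nonswitching block contains only positive elements. Let $M_1,\dots,M_m$ be the positive nonswitching blocks ordered by increasing least element, $a_i=\min M_i$, $\mu_i=|M_i|$; let $P_1,\dots,P_k$ be the switching blocks ordered by increasing least positive element, and $\nu_i$ the number of positive elements of $P_i$. Then $a(\pi)=(a_1,\dots,a_m)$, $\mu(\pi)=(\mu_1,\dots,\mu_m)$, $\nu(\pi)=(\nu_1,\dots,\nu_k)$. *)

(* Defs.v *)
From HB Require Import structures.
From mathcomp Require Import all_boot all_order all_fingroup all_algebra.
From mathcomp Require Import boolp classical_sets reals.

Set Implicit Arguments.
Unset Strict Implicit.
Unset Printing Implicit Defensive.

Import Order.TTheory GRing.Theory Num.Theory.
Local Open Scope ring_scope.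

(* The set Lambda = {1, ..., n, -1, ..., -n, 0}: None is 0, and Some (b, i) is
   the integer (-1) ^ b * (i + 1), coordinates being numbered from 0 in 'I_n. *)
Definition Lambda (n : nat) : finType := option (bool * 'I_n).

Definition lval n (s : Lambda n) : int :=
  if s is Some (b, i) then (-1) ^+ b * (i : nat).+1%:Z else 0.

(* x_s for s in Lambda, with x_{-i} = - x_i and x_0 = 0. *)
Definition lcoord (R : realType) n (x : 'rV[R]_n) (s : Lambda n) : R :=
  if s is Some (b, i) then (-1) ^+ b * x 0 i else 0.

Inductive hyperplane (R : realType) n : set 'rV[R]_n -> Prop :=
| Hyp_eq (i j : 'I_n) of i != j :
    hyperplane [set x : 'rV[R]_n | x 0 i = x 0 j]%classic
| Hyp_opp (i j : 'I_n) of i != j :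
    hyperplane [set x : 'rV[R]_n | x 0 i = - x 0 j]%classic
| Hyp_zero (i : 'I_n) :
    hyperplane [set x : 'rV[R]_n | x 0 i = 0]%classic.

(* The family HH may be empty, in which case L is the whole space. *)
Definition classical_subspace (R : realType) n (L : set 'rV[R]_n) : Prop :=
  exists HH : set (set 'rV[R]_n),
    (forall H, HH H -> hyperplane H) /\ L = (\bigcap_(H in HH) H)%classic.

Definition Part (R : realType) n (L : set 'rV[R]_n) : {set {set Lambda n}} :=
  equivalence_partition
    (fun s t => `[< forall x, L x -> lcoord x s = lcoord x t >])
    [set: Lambda n].

Definition classical_partition (R : realType) n (P : {set {set Lambda n}}) :
  Prop := exists L : set 'rV[R]_n, classical_subspace L /\ P = Part L.

Definition signed_perm (R : realType) n (sigma : 'S_n)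
    (eps : {ffun 'I_n -> bool}) (x : 'rV[R]_n) : 'rV[R]_n :=
  \row_i ((-1) ^+ eps i * x 0 (sigma i)).

(* The type of Part L: the orbit of L under all signed permutations. *)
Definition subspace_type (R : realType) n (L : set 'rV[R]_n) :
    set (set 'rV[R]_n) :=
  [set L' | exists sigma eps, L' = signed_perm sigma eps @` L]%classic.

Definition bump_edge (T : finType) (ground : {set T}) (lt : rel T)
    (P : {set {set T}}) (s s' : T) : Prop :=
  [/\ s \in ground, s' \in ground, lt s s' &
      exists2 B, B \in P &
        [/\ s \in B, s' \in B &
            forall u, u \in B -> u \in ground -> ~~ (lt s u && lt u s')]].

Definition noncrossing (T : finType) (ground : {set T}) (lt : rel T)
    (P : {set {set T}}) : Prop :=
  forall a b c d, lt a b -> lt b c -> lt c d ->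
    ~ (bump_edge ground lt P a c /\ bump_edge ground lt P b d).

Definition nonnesting (T : finType) (ground : {set T}) (lt : rel T)
    (P : {set {set T}}) : Prop :=
  forall a b c d, lt a b -> lt b c -> lt c d ->
    ~ (bump_edge ground lt P a d /\ bump_edge ground lt P b c).

Definition nonzero n : {set Lambda n} := [set s | lval s != 0].

Definition nn_lt n : rel (Lambda n) := fun s t => lval s < lval t.

(* The order -1 < -2 < ... < -n < 1 < 2 < ... < n; only meaningful on nonzero
   elements. *)
Definition nc_lt n : rel (Lambda n) := fun s t =>
  ((lval s < 0) && (0 < lval t)) ||
  (((lval s < 0) == (lval t < 0)) && (`|lval s| < `|lval t|)).

Definition classical_noncrossing (R : realType) n (P : {set {set Lambda n}}) :=
  classical_partition R P /\ noncrossing (nonzero n) (@nc_lt n) P.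

Definition classical_nonnesting (R : realType) n (P : {set {set Lambda n}}) :=
  classical_partition R P /\ nonnesting (nonzero n) (@nn_lt n) P.

Definition switching n (B : {set Lambda n}) : bool :=
  [exists s in B, 0 < lval s] && [exists s in B, lval s <= 0].

Definition pos_nonswitching n (B : {set Lambda n}) : bool :=
  [forall s in B, 0 < lval s].

(* enum 'I_n is increasing, so the head is the least positive element of B
   (0 if B has no positive element). *)
Definition minpos n (B : {set Lambda n}) : nat :=
  head 0%N [seq (val i).+1 | i : 'I_n <- enum 'I_n & Some (false, i) \in B].

Definition blocks_by_minpos n (P : {set {set Lambda n}})
    (p : pred {set Lambda n}) : seq {set Lambda n} :=
  sort (fun B C => (minpos B <= minpos C)%N) [seq B <- enum P | p B].

Definition stat_a n (P : {set {set Lambda n}}) : seq nat :=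
  [seq minpos M | M <- blocks_by_minpos P (@pos_nonswitching n)].

Definition stat_mu n (P : {set {set Lambda n}}) : seq nat :=
  [seq #|M| | M : {set Lambda n} <- blocks_by_minpos P (@pos_nonswitching n)].

Definition stat_nu n (P : {set {set Lambda n}}) : seq nat :=
  [seq #|[set s in B | 0 < lval s]|
    | B : {set Lambda n} <- blocks_by_minpos P (@switching n)].

Definition same_stats n (P P' : {set {set Lambda n}}) : Prop :=
  [/\ stat_a P' = stat_a P, stat_mu P' = stat_mu P & stat_nu P' = stat_nu P].

(* Main.v *)
Require Import Defs.
From mathcomp Require Import all_boot all_order all_fingroup all_algebra.
From mathcomp Require Import boolp classical_sets reals zify.

(** Reading [1, ..., n] from left to right, record at each [i] the label of the
    block of [i].  In a nonnesting (resp. noncrossing) partition, negation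
    reverses the order of the switching blocks by least positive element, so
    that the partition is determined by this word; in particular two partitions
    with the same statistics have words that differ by a permutation of the
    coordinates, hence the same type.

    Say that a label is active at [i] if its block is switching or has an
    element below [i].  The data [a], [mu], [nu] say where the other blocks
    open and how often each label is used, so that the word is determined by
    the choice of an active label with remaining uses at each non-opening
    position.  Noncrossing words are those obtained by treating the active
    labels as a stack, and nonnesting ones as a queue, the switching blocks
    being there from the start with the first one served first.  Both
    disciplines select the active label of least key, for two different keys;
    a word obeying such a rule is unique, and it is reached from any word with
    the same statistics by exchanging labels from left to right. *)

Set Implicit Arguments.
Unset Strict Implicit.
Unset Printing Implicit Defensive.

Import Order.TTheory GRing.Theory Num.Theory.

(** * Greedy words *)

Section Greedy.

Variables (n k : nat) (key0 key1 : nat -> nat).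
Implicit Types (w : 'I_n -> nat) (l : nat).

Definition seen w l (x : nat) := [exists y : 'I_n, (y < x) && (w y == l)].

Definition active w l x := (l < k) || seen w l x.

Definition lastpos w l (x : nat) := \max_(y : 'I_n | (y < x) && (w y == l)) y.

Definition key w l x := if seen w l x then key1 (lastpos w l x) else key0 l.

(** The [exists2] clause says that [l] has uses left. A position opening a nonswitching block is
    unconstrained, its label not being active there. *)
Definition greedy_at w (x : 'I_n) := forall l, l <> w x ->
  active w (w x) x -> active w l x -> (exists2 s : 'I_n, x < s & w s = l) ->
  key w (w x) x < key w l x.

Definition greedy w := forall x, greedy_at w x.

(** Equality of the statistics, in terms of words. Stating the opener clause for both words makes
    the relation symmetric. *)
Definition similar w w' :=
  [/\ forall l, #|[set x | w x == l]| = #|[set x | w' x == l]|,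
      forall x : 'I_n, ~~ active w (w x) x -> w' x = w x
    & forall x : 'I_n, ~~ active w' (w' x) x -> w' x = w x].

Lemma seenP w l x : reflect (exists2 y : 'I_n, y < x & w y = l) (seen w l x).
Proof.
apply: (iffP existsP) => [[y /andP[yx /eqP wy]]|[y yx wy]]; first by exists y.
by exists y; rewrite yx wy /=.
Qed.

Lemma seen_mono w l x y : x <= y -> seen w l x -> seen w l y.
Proof. by move=> xy /seenP[z zx wz]; apply/seenP; exists z; first lia. Qed.

Lemma active_mono w l x y : x <= y -> active w l x -> active w l y.
Proof. by move=> xy /orP[lk|/(seen_mono xy) s]; rewrite /active ?lk ?s ?orbT. Qed.

Lemma lastpos_eq w l x (y : 'I_n) : y < x -> w y = l ->
  (forall z : 'I_n, y < z < x -> w z <> l) -> lastpos w l x = y.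
Proof.
move=> yx wy last; apply/eqP; rewrite eqn_leq; apply/andP; split.
  apply/bigmax_leqP => z /andP[zx /eqP wz]; rewrite leqNgt; apply/negP => yz.
  by apply: (last z) => //; rewrite yz.
by rewrite /lastpos (bigop.bigmax_sup y) //= yx wy /=.
Qed.

Lemma lastposP w l x : seen w l x -> exists y : 'I_n,
  [/\ y < x, w y = l, lastpos w l x = y
    & forall z : 'I_n, y < z < x -> w z <> l].
Proof.
move=> /existsP[y0 py0].
have := @arg_maxnP _ y0 (fun y : 'I_n => (y < x) && (w y == l)) (@nat_of_ord n) py0.
case=> y /andP[yx /eqP wy] ymax; exists y.
have last (z : 'I_n) : y < z < x -> w z <> l.
  by move=> /andP[yz zx] wz; have := ymax z; rewrite zx wz eqxx; lia.
by split=> //; apply: lastpos_eq.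
Qed.

Lemma first_occurrence w (x : 'I_n) : exists y : 'I_n,
  [/\ y <= x, w y = w x & ~~ seen w (w x) y].
Proof.
have [y /eqP wy ymin] := @arg_minnP _ x (fun y => w y == w x) (@nat_of_ord n) (eqxx _).
exists y; split=> //; first exact: ymin.
by apply/negP => /seenP[z zy wz]; have := ymin z; rewrite wz eqxx; lia.
Qed.

Section Prefix.

Variables (w w' : 'I_n -> nat) (x : nat).
Hypothesis ww' : forall y : 'I_n, y < x -> w y = w' y.

Lemma seen_prefix l : seen w l x = seen w' l x.
Proof.
by apply/seenP/seenP=> -[y yx wy]; exists y; rewrite // -wy; [rewrite ww'|apply: ww'].
Qed.

Lemma active_prefix l : active w l x = active w' l x.
Proof. by rewrite /active seen_prefix. Qed.

Lemma key_prefix l : key w l x = key w' l x.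
Proof.
rewrite /key seen_prefix /lastpos; congr (if _ then key1 _ else _).
by apply: eq_bigl => y; case: ltnP => //= yx; rewrite ww'.
Qed.

End Prefix.

Lemma later_occurrence w w' (x : 'I_n) :
  (forall l, #|[set x | w x == l]| = #|[set x | w' x == l]|) ->
  (forall y : 'I_n, y < x -> w y = w' y) -> w x <> w' x ->
  exists2 s : 'I_n, x < s & w s = w' x.
Proof.
move=> cnt pre neq.
case: (boolP [exists s : 'I_n, (x < s) && (w s == w' x)]) => [/existsP[s]|/existsPn no].
  by case/andP=> xs /eqP; exists s.
(* All occurrences of this label in [w] lie in the common prefix, hence also in [w'], where [x] is
   one more. *)
have : [set y | w y == w' x] \proper [set y | w' y == w' x].
  apply/properP; split.
    apply/fintype.subsetP => y; rewrite !inE => /eqP wy.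
    case: (ltngtP y x) => [yx|xy|/val_inj yx].
    - by rewrite -pre // wy.
    - by have := no y; rewrite xy wy eqxx.
    - by case: neq; rewrite -yx wy yx.
  by exists x; rewrite !inE //; apply/eqP.
by move/proper_card; rewrite cnt ltnn.
Qed.

(** At the first disagreement both labels are active, since openers are shared, and by counting each
    word still has to use the label chosen by the other. Keys depend on the prefix only, so each key
    would be below the other. *)
Lemma greedy_unique w w' : similar w w' -> greedy w -> greedy w' -> w =1 w'.
Proof.
move=> [cnt op op'] gw gw'.
suff H m (x : 'I_n) : x < m -> w x = w' x by move=> x; apply: (H n).
elim: m x => // m IH x; rewrite ltnS => xm.
have pre (y : 'I_n) : y < x -> w y = w' y by move=> yx; apply: IH; lia.
apply/eqP/negP => /negP/eqP neq.
have a1 : active w (w x) x by apply/negP => /negP/op /esym.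
have a2 : active w' (w' x) x by apply/negP => /negP/op' /esym.
have s1 := later_occurrence cnt pre neq.
have s2 : exists2 s : 'I_n, x < s & w' s = w x.
  apply: (@later_occurrence w' w) => [l|y yx|]; first by rewrite cnt.
    by rewrite pre.
  by move/esym.
have := gw x (w' x) (nesym neq) a1; rewrite (active_prefix pre) => /(_ a2 s1).
have := gw' x (w x) neq a2; rewrite -(active_prefix pre) => /(_ a1 s2).
by rewrite !(key_prefix pre); lia.
Qed.

(** If the label of [x] had occurred earlier in [w'], its first occurrence there would be an opener
    of [w'], hence an occurrence in [w] before [x]. *)
Lemma similar_opener w w' (x : 'I_n) : similar w w' ->
  ~~ active w (w x) x -> ~~ active w' (w' x) x.
Proof.
move=> [_ op op'] nact; rewrite op //; move: (nact); rewrite /active !negb_or.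
move=> /andP[-> /negP ns] /=; apply/negP => /seenP[y yx wy].
have [z [zy wz nz]] := first_occurrence w' y.
have wz' : w z = w x.
  rewrite -wy -wz; apply/esym/op'; rewrite wz /active (negPf nz) orbF wy.
  by move: nact; rewrite negb_or => /andP[].
by apply: ns; apply/seenP; exists z => //; lia.
Qed.

Lemma similar_sym w w' : similar w w' -> similar w' w.
Proof. by move=> [c o o']; split=> [l|x /o' ->|x /o ->]. Qed.

Lemma similar_trans w1 w2 w3 : similar w1 w2 -> similar w2 w3 -> similar w1 w3.
Proof.
move=> s12 s23; have [c12 o12 o12'] := s12; have [c23 o23 o23'] := s23.
have s32 := similar_sym s23.
split=> [l|x nx|x nx]; first by rewrite c12.
  by rewrite -(o12 _ nx); apply: o23; apply: similar_opener s12 nx.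
by rewrite (o23' _ nx); apply: o12'; apply: similar_opener s32 nx.
Qed.

Hypothesis key0_inj : forall l l', l < k -> l' < k -> key0 l = key0 l' -> l = l'.
Hypothesis key1_inj : forall y y', y < n -> y' < n -> key1 y = key1 y' -> y = y'.
Hypothesis key01 : forall l y, l < k -> y < n -> key0 l <> key1 y.

(** A used label is recovered from its last position, so active labels never tie and a minimal key
    is strictly minimal. *)
Lemma key_inj w l l' x : active w l x -> active w l' x ->
  key w l x = key w l' x -> l = l'.
Proof.
rewrite /active /key.
case: (boolP (seen w l x)) => [/lastposP[y [yx wy -> _]]|_];
case: (boolP (seen w l' x)) => [/lastposP[y' [yx' wy' -> _]]|_]; rewrite ?orbT ?orbF => a a'.
- by move/key1_inj => /(_ (ltn_ord _) (ltn_ord _)) /val_inj yy; rewrite -wy -wy' yy.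
- by move/esym/key01 => H; case: H.
- by move/key01 => H; case: H.
- exact: key0_inj.
Qed.

(* Swapping the label at [t] with the later one of least key makes the word
   greedy at [t], without disturbing the prefix. *)
Lemma greedy_step w (t : 'I_n) : (forall x : 'I_n, x < t -> greedy_at w x) ->
  exists2 w', similar w w' & forall x : 'I_n, x <= t -> greedy_at w' x.
Proof.
move=> gt; case: (boolP (active w (w t) t)) => [at_|nat_]; last first.
  exists w => // x; rewrite leq_eqVlt => /orP[/eqP/val_inj->|/gt//].
  by move=> l _ a; rewrite a in nat_.
have t0 : (t <= t) && active w (w t) t by rewrite leqnn.
have [s /andP[ts as_] smin] :=
  @arg_minnP _ t (fun s : 'I_n => (t <= s) && active w (w s) t) (fun s => key w (w s) t) t0.
pose w' := w \o tperm t s.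
have pre (y : 'I_n) : y < t -> w y = w' y.
  by move=> yt; rewrite /w' /= tpermD //; apply/eqP => e; subst; lia.
(* Both swapped positions are at least [t], so nothing crosses a bound [x <= t]. *)
have tp (x y : 'I_n) : x <= t -> (x <= tperm t s y) = (x <= y).
  by move=> xt; case: tpermP => [->|->|//]; lia.
exists w'.
  split.
  - move=> l; rewrite -[RHS](card_preimset _ (@perm_inj _ (tperm t s))).
    congr #|pred_of_set _|; apply/setP => x.
    by rewrite !inE /w' /= tpermK.
  (* In neither word is a swapped position an opener: both labels are active at [t], hence also at
     [s]. *)
  - move=> x; rewrite /w' /=; case: tpermP => [->|->|//]; first by rewrite at_.
    by rewrite (active_mono ts as_).
  - move=> x; rewrite /w' /=; case: tpermP => [->|->|//].
      by rewrite -(active_prefix pre) as_.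
    by rewrite (active_mono ts) // -(active_prefix pre).
move=> x xt l lx a1 a2 [r xr wr].
have prex (y : 'I_n) : y < x -> w y = w' y by move=> yx; apply: pre; lia.
move: a1 a2; rewrite -!(active_prefix prex) -!(key_prefix prex) => a1 a2.
case: (ltngtP x t) xt => // [xt _|/val_inj xt _].
  have wx : w' x = w x by rewrite -pre.
  rewrite wx in lx a1 *; apply: gt => //; exists (tperm t s r) => //.
  have := tp x r (ltnW xt); case: (ltngtP x (tperm t s r)) => // [|e _]; first by lia.
  move: xr; suff -> : r = x by rewrite ltnn.
  by rewrite -[r](tpermK t s) -(val_inj e) tpermD //; apply/eqP => e'; subst; lia.
subst x; have wt : w' t = w s by rewrite /w' /= tpermL.
rewrite wt in a1 lx *; rewrite ltn_neqAle; apply/andP; split.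
  by apply/eqP => /(key_inj a1 a2) /esym.
rewrite -wr; apply: (smin (tperm t s r)).
rewrite tp //.
by rewrite (ltnW xr) /=; move: a2; rewrite -wr.
Qed.

Lemma greedy_exists w : exists2 w', similar w w' & greedy w'.
Proof.
suff H t : t <= n ->
    exists2 w', similar w w' & forall x : 'I_n, x < t -> greedy_at w' x.
  by have [w' sw gw] := H n (leqnn n); exists w' => // x; apply: gw.
elim: t => [|t IH] tn; first by exists w.
have [w1 s1 g1] := IH (ltnW tn).
have [w2 s2 g2] := @greedy_step w1 (Ordinal tn) g1.
exists w2; last by move=> x; rewrite ltnS; apply: g2.
exact: similar_trans s1 s2.
Qed.

End Greedy.

(** * Blocks and edges of equivalence relations on Lambda *)

Local Notation pos i := (Some (false, i)).
Local Notation neg i := (Some (true, i)).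
Local Notation epart E := (equivalence_partition E [set: _]).

Definition lneg n (s : Lambda n) : Lambda n :=
  if s is Some (b, i) then Some (~~ b, i) else None.

Lemma lnegK n : involutive (@lneg n).
Proof. by case=> [[[] i]|]. Qed.

Lemma lvalE n b (i : 'I_n) :
  lval (Some (b, i)) = if b then (- Posz i.+1)%R else Posz i.+1.
Proof. by rewrite /lval; case: b; rewrite ?expr1 ?expr0 ?mulN1r ?mul1r. Qed.

Lemma lval_gt0 n (s : Lambda n) :
  (0 < lval s)%R = if s is pos i then true else false.
Proof. by case: s => [[[] i]|]. Qed.

Lemma in_nonzero n (s : Lambda n) : (s \in nonzero n) = (s != None).
Proof. by rewrite inE; case: s => [[[] i]|]. Qed.

(* The two orders on [nonzero n] differ only among the negative elements. *)
Definition slt (nc : bool) n : rel (Lambda n) :=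
  if nc then @nc_lt n else @nn_lt n.

Arguments slt : simpl never.

Lemma sltE nc n b (i : 'I_n) c (j : 'I_n) :
  slt nc (Some (b, i)) (Some (c, j)) =
  if b then (if c then (if nc then i < j else j < i) else true)
  else ~~ c && (i < j).
Proof. by rewrite /slt; case: nc; rewrite /nc_lt /nn_lt !lvalE; case: b; case: c; lia. Qed.

Lemma mem_epart (T : finType) (E : rel T) (B : {set T}) :
  reflect (exists s, B = [set t | E s t]) (B \in epart E).
Proof.
have H s : [set y in [set: T] | E s y] = [set t | E s t].
  by apply/setP => t; rewrite !inE.
by apply: (iffP imsetP) => [[s _ ->]|[s ->]]; exists s; rewrite ?H ?inE.
Qed.

Lemma eq_epart (T : finType) (E E' : rel T) : E =2 E' -> epart E = epart E'.
Proof.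
move=> EE'; apply/setP => B; apply/mem_epart/mem_epart => -[s ->]; exists s;
by apply/setP => t; rewrite !inE EE'.
Qed.

Lemma minpos_eq n (B : {set Lambda n}) (i : 'I_n) : pos i \in B ->
  (forall j : 'I_n, j < i -> pos j \notin B) -> minpos B = i.+1.
Proof.
rewrite /minpos => iB iB'.
have : i \in [seq j <- enum 'I_n | pos j \in B] by rewrite mem_filter iB mem_enum.
have : sorted ltn [seq val j | j <- [seq j <- enum 'I_n | pos j \in B]].
  rewrite sorted_map; apply: sorted_filter; first by move=> a b c /= ; lia.
  by rewrite -sorted_map val_enum_ord iota_ltn_sorted.
have : all (fun j => pos j \in B) [seq j <- enum 'I_n | pos j \in B] by apply: filter_all.
case: [seq j <- enum 'I_n | pos j \in B] => //= h s /andP[hB _] pth.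
rewrite inE => /orP[/eqP -> //|si].
have := order_path_min ltn_trans pth => /allP /(_ (val i) (map_f _ si)) /= hi.
by move: (iB' _ hi); rewrite hB.
Qed.

Lemma minposP n (B : {set Lambda n}) (i : 'I_n) : pos i \in B ->
  exists j : 'I_n, [/\ j <= i, pos j \in B, minpos B = j.+1
    & forall l : 'I_n, l < j -> pos l \notin B].
Proof.
move=> iB.
have [j jB jmin] := @arg_minnP _ i (fun j => pos j \in B) (@nat_of_ord n) iB.
have lB (l : 'I_n) : l < j -> pos l \notin B.
  by move=> lj; apply/negP => /jmin; lia.
by exists j; split=> //; [exact: jmin|exact: minpos_eq].
Qed.

(** Sorted lists of blocks can thus be compared by membership alone. *)
Lemma minpos_inj_list n (s1 s2 : seq {set Lambda n}) :
  sorted ltn (map (@minpos n) s1) -> sorted ltn (map (@minpos n) s2) ->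
  s1 =i s2 -> s1 = s2.
Proof.
rewrite !sorted_map; apply: irr_sorted_eq => [a b c /=|a /=]; last by rewrite ltnn.
exact: ltn_trans.
Qed.

Lemma mem_blocks n (P : {set {set Lambda n}}) p B :
  (B \in blocks_by_minpos P p) = (B \in P) && p B.
Proof. by rewrite mem_sort mem_filter mem_enum andbC. Qed.

Lemma switching_pos n (B : {set Lambda n}) : switching B -> exists i, pos i \in B.
Proof.
case/andP=> /existsP[s /andP[sB]]; rewrite lval_gt0 => + _.
by case: s sB => [[[] i]|] // iB _; exists i.
Qed.

Lemma nonswitchingE n (B : {set Lambda n}) i : pos i \in B ->
  pos_nonswitching B = ~~ switching B.
Proof.
move=> iB; have pB : [exists s in B, (0 < lval s)%R].
  by apply/existsP; exists (pos i); rewrite iB lval_gt0.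
rewrite /switching pB /pos_nonswitching negb_exists /=; apply: eq_forallb => s.
by rewrite leNgt negb_and negbK implybE.
Qed.

Section Equiv.

Variables (n : nat) (E : rel (Lambda n)).
Hypothesis eqE : equivalence_rel E.

Local Notation cls s := [set t | E s t].

Lemma equiv_refl s : E s s. Proof. by have [] := eqE s s s. Qed.

Lemma equiv_left s t : E s t -> E s =1 E t.
Proof. by move=> st u; have [_ ->] := eqE s t u. Qed.

Lemma equiv_sym s t : E s t = E t s.
Proof.
by apply/idP/idP => /equiv_left e; [rewrite -e|rewrite -e]; apply: equiv_refl.
Qed.

Lemma equiv_trans s t u : E s t -> E t u -> E s u.
Proof. by move=> /equiv_left ->. Qed.

Lemma cls_eq s t : (cls s == cls t) = E s t.
Proof.
apply/eqP/idP => [/setP/(_ t)|/equiv_left e].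
  by rewrite !inE equiv_refl.
by apply/setP => u; rewrite !inE e.
Qed.

Lemma mem_cls B s : B \in epart E -> s \in B -> B = cls s.
Proof.
move=> /mem_epart[t ->]; rewrite inE => st; apply/eqP; by rewrite cls_eq.
Qed.

Lemma nonswitching_pos B :
  B \in epart E -> pos_nonswitching B -> exists i, pos i \in B.
Proof.
move=> /mem_epart[s ->] /forallP /(_ s).
rewrite inE equiv_refl lval_gt0; case: s => [[[] i]|] // _.
by exists i; rewrite inE equiv_refl.
Qed.

Lemma bump_edgeP lt s t : bump_edge (nonzero n) lt (epart E) s t <->
  [/\ s != None, t != None, lt s t, E s t
    & forall u, u != None -> E s u -> ~~ (lt s u && lt u t)].
Proof.
rewrite /bump_edge !in_nonzero; split.
  case=> s0 t0 st [B BP [sB tB H]]; rewrite (mem_cls BP sB) inE in tB.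
  split=> // u u0 su; apply: H; last by rewrite in_nonzero.
  by rewrite (mem_cls BP sB) inE.
case=> s0 t0 st est H; split=> //; exists (cls s); first by apply/mem_epart; exists s.
rewrite !inE equiv_refl; split=> // u; rewrite inE in_nonzero => su u0; exact: H.
Qed.

Lemma edge_pp nc (i j : 'I_n) :
  bump_edge (nonzero n) (@slt nc n) (epart E) (pos i) (pos j) <->
  [/\ i < j, E (pos i) (pos j) & forall l : 'I_n, i < l < j -> ~~ E (pos i) (pos l)].
Proof.
rewrite bump_edgeP; split.
  case=> _ _; rewrite sltE /= => ij eij H; split=> // l ilj.
  by apply/negP => el; move: (H (pos l) isT el); rewrite !sltE /= ilj.
case=> ij eij H; split=> //; first by rewrite sltE.
case=> // -[b l] _ el; rewrite !sltE; case: b el => //= el.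
by apply/negP => /H; rewrite el.
Qed.

(** Only smaller positives and later negatives can lie between, and later means of larger absolute
    value under [nc], of smaller one otherwise. *)
Lemma edge_np nc (i j : 'I_n) :
  bump_edge (nonzero n) (@slt nc n) (epart E) (neg i) (pos j) <->
  [/\ E (neg i) (pos j),
      forall l : 'I_n, (if nc then i < l else l < i) -> ~~ E (neg i) (neg l)
    & forall l : 'I_n, l < j -> ~~ E (neg i) (pos l)].
Proof.
rewrite bump_edgeP; split.
  case=> _ _ _ eij H; split=> // l il; apply/negP => el.
    by move: (H (neg l) isT el); rewrite !sltE il.
  by move: (H (pos l) isT el); rewrite !sltE il.
case=> eij H H'; split=> //; first by rewrite sltE.
case=> // -[b l] _ el; rewrite !sltE; case: b el => //= el; rewrite ?andbT.
  by apply/negP => /H; rewrite el.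
by apply/negP => /H'; rewrite el.
Qed.

Hypothesis Eneg : forall s t, E (lneg s) (lneg t) = E s t.

(** Negation sends negatives to positives, keeping the order under [nc] and reversing it
    otherwise. *)
Lemma edge_nn nc (i j : 'I_n) :
  bump_edge (nonzero n) (@slt nc n) (epart E) (neg i) (neg j) <->
  if nc then bump_edge (nonzero n) (@slt nc n) (epart E) (pos i) (pos j)
  else bump_edge (nonzero n) (@slt nc n) (epart E) (pos j) (pos i).
Proof.
have En (a b : 'I_n) : E (neg a) (neg b) = E (pos a) (pos b) by rewrite -Eneg.
case: nc; rewrite bump_edgeP edge_pp; (split; last first).
- case=> ij eij H; split=> //; rewrite ?sltE ?En //.
  case=> // -[b l] _ el; rewrite !sltE; case: b el => //= el.
  by apply/negP => /H; rewrite -En el.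
- case=> _ _; rewrite sltE En => ij eij H; split=> // l ilj.
  by apply/negP => el; move: (H (neg l) isT); rewrite !sltE En el ilj => /(_ isT).
- case=> ij eij H; split=> //; first by rewrite sltE.
    by rewrite En equiv_sym.
  case=> // -[b l] _ el; rewrite !sltE; case: b el => //= el.
  apply/negP => /andP[li jl]; have := H l; rewrite jl li => /(_ isT).
  by rewrite (equiv_left eij) -En el.
- case=> _ _; rewrite sltE En => ij eij H; split=> //; first by rewrite equiv_sym.
  move=> l /andP[jl li]; apply/negP => el; move: (H (neg l) isT).
  by rewrite !sltE En jl li (equiv_left eij) el => /(_ isT).
Qed.

Lemma blocks_sorted (p : pred {set Lambda n}) :
  (forall B, B \in epart E -> p B -> exists i, pos i \in B) ->
  sorted ltn [seq minpos B | B <- blocks_by_minpos (epart E) p].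
Proof.
move=> hp; rewrite ltn_sorted_uniq_leq; apply/andP; split.
  rewrite map_inj_in_uniq => [|B C].
    by rewrite sort_uniq; apply/filter_uniq/enum_uniq.
  rewrite !mem_blocks => /andP[BP pB] /andP[CP pC].
  have [i iB] := hp B BP pB; have [j jC] := hp C CP pC.
  have [i' [_ iB' -> _]] := minposP iB; have [j' [_ jC' -> _]] := minposP jC.
  by case=> /val_inj ij; rewrite (mem_cls BP iB') ij (mem_cls CP jC').
rewrite sorted_map; apply: sort_sorted => B C; exact: leq_total.
Qed.

End Equiv.

(** * Partitions encoded by words *)

Section Words.

Variables (n k : nat).
Implicit Types (w : 'I_n -> nat) (l m : nat).

(* The labels [l < k] of the switching blocks are sent to
   [1 - k, 3 - k, ..., k - 1], so that the block opposite to the one labelled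
   [l] is labelled [k - 1 - l], and the zero block has code [0]. *)
Definition code l : int := if l < k then (Posz l.*2.+1 - Posz k)%R else Posz l.+1.

Definition level w (s : Lambda n) : int :=
  if s is Some (b, i) then if b then (- code (w i))%R else code (w i) else 0%R.

Definition level_rel w : rel (Lambda n) := fun s t => level w s == level w t.

Definition word_part w := epart (level_rel w).

Definition block w l : {set Lambda n} := [set s | code l == level w s].

(** The last clause numbers the labels below [k], and separately those from [k] on, by first
    occurrence: the order in which the statistics list their blocks. *)
Definition normal m w :=
  [/\ forall i, w i < k + m,
      forall l, l < k + m -> exists i, w i = l
    & forall l (j : 'I_n), l < w j -> (w j < k) || (k <= l) -> seen w l j].

Lemma code_eq l l' : (code l == code l') = (l == l').
Proof. by rewrite /code; case: ltnP => ?; case: ltnP => ?; lia. Qed.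

Lemma code_opp l l' : (code l == (- code l')%R) = ((l + l').+1 == k).
Proof. by rewrite /code; case: ltnP => ?; case: ltnP => ?; lia. Qed.

Lemma level_equiv w : equivalence_rel (level_rel w).
Proof. by move=> s t u; split=> [|/eqP st]; rewrite /level_rel ?eqxx ?st. Qed.

Lemma level_lneg w s : level w (lneg s) = (- level w s)%R.
Proof. by case: s => [[[] i]|] //=; rewrite ?opprK ?oppr0. Qed.

Lemma level_rel_neg w s t : level_rel w (lneg s) (lneg t) = level_rel w s t.
Proof. by rewrite /level_rel !level_lneg eqr_opp. Qed.

Lemma level_pp w i j : level_rel w (pos i) (pos j) = (w i == w j).
Proof. exact: code_eq. Qed.

Lemma level_nn w i j : level_rel w (neg i) (neg j) = (w i == w j).
Proof. by rewrite /level_rel /= eqr_opp code_eq. Qed.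

Lemma level_np w i j : level_rel w (neg i) (pos j) = ((w i + w j).+1 == k).
Proof. by rewrite /level_rel eq_sym /= code_opp addnC. Qed.

Lemma level_pn w i j : level_rel w (pos i) (neg j) = ((w i + w j).+1 == k).
Proof. by rewrite /level_rel /= code_opp. Qed.

Lemma pos_block w l i : (pos i \in block w l) = (l == w i).
Proof. by rewrite inE /= code_eq. Qed.

Lemma neg_block w l i : (neg i \in block w l) = ((l + w i).+1 == k).
Proof. by rewrite inE /= code_opp. Qed.

Lemma block_in_part w i : block w (w i) \in word_part w.
Proof. by apply/mem_epart; exists (pos i). Qed.

Lemma part_block w B i : B \in word_part w -> pos i \in B -> B = block w (w i).
Proof. by move=> BP iB; rewrite (mem_cls (@level_equiv w) BP iB). Qed.

Lemma minpos_block w i : ~~ seen w (w i) i -> minpos (block w (w i)) = i.+1.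
Proof.
move=> ns; apply: minpos_eq => [|j ji]; rewrite pos_block //.
by apply: contra ns => /eqP wj; apply/seenP; exists j.
Qed.

Lemma block_minpos w (i j : 'I_n) : minpos (block w (w i)) = j.+1 ->
  w j = w i /\ ~~ seen w (w i) j.
Proof.
have [y [_ wy ns]] := first_occurrence w i.
by rewrite -wy minpos_block wy // => -[/val_inj <-]; rewrite wy.
Qed.

Lemma pos_block_card w l :
  #|[set s in block w l | (0 < lval s)%R]| = #|[set i | w i == l]|.
Proof.
rewrite -(card_imset _ (_ : injective (fun i : 'I_n => pos i))); last by move=> i j [].
congr #|pred_of_set _|; apply/setP => s; rewrite finset.in_set lval_gt0.
apply/andP/imsetP => [[]|[i]].
  by case: s => [[[] i]|] //; rewrite pos_block eq_sym => wi _; exists i; rewrite ?inE.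
by rewrite inE eq_sym => wi ->; rewrite pos_block.
Qed.

(** * Statistics of the partition of a normal word *)

Section Normal.

Variables (m : nat) (w : 'I_n -> nat).
Hypothesis nw : normal m w.

(** For a label below [k] the opposite label [k - 1 - l] is in use, and its negatives lie in the
    block. The code of a label from [k] on is neither zero nor opposite to any code. *)
Lemma switching_block l : l < k + m -> switching (block w l) = (l < k).
Proof.
have [_ surj _] := nw => lkm; have [i wi] := surj l lkm.
apply/andP/idP => [[_ /existsP[s /andP[]]]|lk].
  rewrite inE leNgt lval_gt0; case: s => [[[] j]|] //= .
    by rewrite code_opp; lia.
  by rewrite /code; case: ltnP => ?; lia.
split; apply/existsP; first by exists (pos i); rewrite pos_block wi eqxx lval_gt0.
have [|j wj] := surj (k - l.+1); first by lia.
by exists (neg j); rewrite neg_block wj leNgt lval_gt0 andbT; lia.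
Qed.

Lemma nonswitching_block l : l < k + m -> pos_nonswitching (block w l) = (k <= l).
Proof.
move=> lkm; rewrite leqNgt -switching_block //.
have [_ surj _] := nw; have [i wi] := surj l lkm.
by rewrite (@nonswitchingE _ _ i) ?pos_block ?wi.
Qed.

(** The condition on [a] and [b] keeps the interval on one side of [k], where [normal] makes the
    smaller label occur first. *)
Lemma sorted_blocks a b : (b <= k) || (k <= a) -> b <= k + m ->
  sorted ltn [seq minpos B | B <- [seq block w l | l <- iota a (b - a)]].
Proof.
move=> ab bkm; rewrite -map_comp sorted_map.
have : sorted ltn (iota a (b - a)) by apply: iota_ltn_sorted.
apply: sub_in_sorted (allss _) => l l'; rewrite !mem_iota /= => ha hb ll'.
have [_ surj ord] := nw.
have [|i wi] := surj l; first by lia.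
have [|j wj] := surj l'; first by lia.
subst l l'.
have [j' [_ wj' ns]] := first_occurrence w j.
have /seenP[y yj wy] : seen w (w i) j' by apply: ord; rewrite wj' //; lia.
have [i' [iy wi' ns']] := first_occurrence w y.
rewrite /= -wj' (@minpos_block w j') ?wj' // -wy -wi' (@minpos_block w i') ?wi' //; lia.
Qed.

Lemma switching_blocks :
  blocks_by_minpos (word_part w) (@switching n) = [seq block w l | l <- iota 0 k].
Proof.
have [rng surj _] := nw.
apply: minpos_inj_list.
- by apply: blocks_sorted (level_equiv w) _ _ => B _ /switching_pos.
- by have := @sorted_blocks 0 k; rewrite subn0; apply; lia.
move=> B; rewrite mem_blocks; apply/andP/mapP => [[BP sB]|[l]].
  have [i iB] := switching_pos sB; move: sB; rewrite (part_block BP iB).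
  by rewrite switching_block // => wk; exists (w i); rewrite // mem_iota.
rewrite mem_iota /= => lk ->; have [|i wi] := surj l; first by lia.
by rewrite switching_block ?lk; last lia; rewrite -wi block_in_part.
Qed.

Lemma nonswitching_blocks : blocks_by_minpos (word_part w) (@pos_nonswitching n) =
  [seq block w l | l <- iota k m].
Proof.
have [rng surj _] := nw.
have hpos := nonswitching_pos (level_equiv w).
apply: minpos_inj_list.
- exact: blocks_sorted (level_equiv w) _ hpos.
- by have := @sorted_blocks k (k + m); rewrite addKn; apply; lia.
move=> B; rewrite mem_blocks; apply/andP/mapP => [[BP sB]|[l]].
  have [i iB] := hpos B BP sB; move: sB; rewrite (part_block BP iB).
  by rewrite nonswitching_block // => wk; exists (w i); rewrite // mem_iota wk rng.
rewrite mem_iota => /andP[kl lkm] ->; have [i wi] := surj l lkm.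
by rewrite nonswitching_block ?kl // -wi block_in_part.
Qed.

Lemma word_stat_nu : stat_nu (word_part w) = [seq #|[set i | w i == l]| | l <- iota 0 k].
Proof.
by rewrite /stat_nu switching_blocks -map_comp; apply: eq_map => l /=; apply: pos_block_card.
Qed.

Lemma word_stat_mu : stat_mu (word_part w) = [seq #|[set i | w i == l]| | l <- iota k m].
Proof.
rewrite /stat_mu nonswitching_blocks -map_comp; apply/eq_in_map => l.
rewrite mem_iota => /andP[kl lkm] /=; rewrite -pos_block_card; congr #|pred_of_set _|.
apply/setP => s; rewrite [in RHS]finset.in_set; move: kl; rewrite -nonswitching_block //.
by move/forallP/(_ s); case: (s \in block w l).
Qed.

Lemma word_stat_a : stat_a (word_part w) = [seq minpos (block w l) | l <- iota k m].
Proof. by rewrite /stat_a nonswitching_blocks -map_comp. Qed.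

End Normal.

(** The least element of a nonswitching block is the position of its opener, which both words
    share. *)
Lemma similar_stats m w w' : normal m w -> normal m w' -> similar k w w' ->
  same_stats (word_part w) (word_part w').
Proof.
move=> nw nw' sim; have [cnt op op'] := sim; rewrite /same_stats.
rewrite !(word_stat_a nw, word_stat_a nw', word_stat_mu nw, word_stat_mu nw',
  word_stat_nu nw, word_stat_nu nw').
split; [|by apply: eq_map => l; rewrite cnt..].
apply/eq_in_map => l; rewrite mem_iota => /andP[kl lkm].
have [_ surj _] := nw; have [i wi] := surj l lkm; subst l.
have [j [_ wj ns]] := first_occurrence w i.
have nact : ~~ active k w (w j) j.
  by rewrite /active negb_or -leqNgt wj kl.
have wj' := op _ nact; have := similar_opener sim nact.
rewrite /active negb_or => /andP[_ ns'].
by rewrite -wj -[in LHS]wj' !minpos_block // wj.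
Qed.

(** Shared openers transport the numbering of the nonswitching labels; the order of the switching
    ones is left as a hypothesis, to be met by the greedy rule. *)
Lemma similar_normal m w w' : normal m w -> similar k w w' ->
  (forall l (j : 'I_n), l < w' j -> w' j < k -> (exists i, w' i = l) ->
     seen w' l j) -> normal m w'.
Proof.
move=> [rng surj ord] [cnt op op'] ord'.
have occ (v v' : 'I_n -> nat) (i : 'I_n) :
  (forall l, #|[set x | v x == l]| = #|[set x | v' x == l]|) -> exists j, v' j = v i.
  move=> cvv; have : 0 < #|[set x | v x == v i]| by apply/card_gt0P; exists i; rewrite inE.
  by rewrite cvv => /card_gt0P[j]; rewrite inE => /eqP; exists j.
split=> [i|l /surj[i <-]|l j lj].
- by have [j <-] := occ w' w i (fun l => esym (cnt l)).
- exact: occ.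
case/orP=> [jk|kl].
  apply: ord' => //; have [|i <-] := surj l; first by lia.
  exact: occ.
have [y [yj wy ns]] := first_occurrence w' j.
have wy' : w y = w' y.
  by apply/esym/op'; rewrite wy /active negb_or ns andbT; lia.
have /seenP[z zy wz] : seen w l y by apply: ord; rewrite ?wy' ?wy ?kl ?orbT.
have [x [xz wx nx]] := first_occurrence w z.
apply/seenP; exists x; first by lia.
by rewrite op ?wx // /active negb_or nx andbT; lia.
Qed.

End Words.

(** List lengths recover [k] and [m]. Labels being numbered in list order, the entries give
    multiplicities and openers label by label. *)
Lemma stats_similar n k k' m m' (w w' : 'I_n -> nat) :
  normal k m w -> normal k' m' w' -> same_stats (word_part k w) (word_part k' w') ->
  k' = k /\ similar k w w'.
Proof.
move=> nw nw' []; rewrite (word_stat_a nw) (word_stat_a nw') (word_stat_mu nw).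
rewrite (word_stat_mu nw') (word_stat_nu nw) (word_stat_nu nw') => sa smu snu.
have ek : k' = k by have := congr1 size snu; rewrite !size_map !size_iota.
have em : m' = m by have := congr1 size smu; rewrite !size_map !size_iota.
subst k' m'; split=> //; move/eq_in_map: sa => sa.
have [rng surj ord] := nw; have [rng' surj' ord'] := nw'.
have opener (v v' : 'I_n -> nat) (x : 'I_n) : normal k m v -> normal k m v' ->
   {in iota k m, forall l, minpos (block k v' l) = minpos (block k v l)} ->
   ~~ active k v (v x) x -> v' x = v x.
  move=> [r _ _] [_ s' _] e; rewrite /active negb_or => /andP[kx ns].
  have [y vy] := s' _ (r x).
  have := e (v x); rewrite mem_iota r leqNgt kx => /(_ isT).
  by rewrite minpos_block // -vy => /block_minpos[].
split=> [l|x|x].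
- case: (ltnP l (k + m)) => lkm.
    have : l \in iota 0 k ++ iota k m by rewrite -iotaD mem_iota.
    rewrite mem_cat => /orP[lk|km]; last by move/eq_in_map: smu => ->.
    by move/eq_in_map: snu => ->.
  have e0 (v : 'I_n -> nat) : (forall i, v i < k + m) -> #|[set x | v x == l]| = 0.
    move=> r; apply/eqP; rewrite cards_eq0; apply/eqP/setP => x; rewrite !inE.
    by have := r x; lia.
  by rewrite !e0.
- exact: opener.
- by move=> nx; apply/esym; move: nx; apply: opener => // l /sa.
Qed.

(** * Nonnesting is first in, first out; noncrossing is last in, first out *)

Section Discipline.

Variables (n k : nat).
Implicit Types (w : 'I_n -> nat) (l m : nat).

(* In the two disciplines a switching label [l] not yet used behaves as if its
   last use were at time [l - k], resp. [- l - 1]; the keys are these times,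
   shifted, in increasing, resp. decreasing order. *)
Definition fifo w := greedy k id (addn k) w.

Definition lifo w := greedy k (fun l => (n + l).+1) (fun y => n - y) w.

Lemma greedy_ord key0 key1 w : {homo key0 : l l' / l <= l'} ->
  greedy k key0 key1 w -> forall l (j : 'I_n), l < w j -> w j < k ->
  (exists i, w i = l) -> seen w l j.
Proof.
move=> mono gw l j lj jk [i wi]; apply: contraT => ns.
have [y [yj wy ny]] := first_occurrence w j.
have nl : ~~ seen w l y by apply/negP => /(seen_mono yj); apply/negP.
have := gw y l; rewrite /key wy (negPf ny) (negPf nl) /active jk (_ : l < k); last by lia.
have ji : j < i.
  case: (ltngtP j i) => // [ij|/val_inj ij]; last by subst; lia.
  by case/negP: ns; apply/seenP; exists i.
move=> H; have : key0 (w j) < key0 l.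
  by apply: H => //; [lia|exists i => //; lia].
by rewrite ltnNge mono // ltnW.
Qed.

Lemma next_occurrence w (x s : 'I_n) : x < s -> exists s' : 'I_n,
  [/\ x < s', w s' = w s & forall z : 'I_n, x < z < s' -> w z <> w s].
Proof.
move=> xs; have p0 : (x < s) && (w s == w s) by rewrite xs eqxx.
have [y /andP[xy /eqP wy] ymin] :=
  @arg_minnP _ s (fun y : 'I_n => (x < y) && (w y == w s)) (@nat_of_ord n) p0.
exists y; split=> // z /andP[xz zy] wz; have := ymin z; rewrite xz wz eqxx; lia.
Qed.

Lemma last_occurrence w (x : 'I_n) : exists y : 'I_n,
  [/\ x <= y, w y = w x & forall z : 'I_n, y < z -> w z <> w x].
Proof.
have [y /eqP wy ymax] := @arg_maxnP _ x (fun y => w y == w x) (@nat_of_ord n) (eqxx _).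
exists y; split=> //; first exact: ymax.
by move=> z yz wz; have := ymax z; rewrite wz eqxx; lia.
Qed.

Local Notation edge nc w := (bump_edge (nonzero n) (@slt nc n) (word_part k w)).

Lemma word_edge_pp nc w (i j : 'I_n) : edge nc w (pos i) (pos j) <->
  [/\ i < j, w i = w j & forall l : 'I_n, i < l < j -> w l <> w i].
Proof.
rewrite edge_pp; last exact: level_equiv.
rewrite level_pp; split=> -[ij /eqP wij H]; split=> // l /H.
  by rewrite level_pp eq_sym => /eqP.
by rewrite level_pp eq_sym => /eqP.
Qed.

Lemma word_edge_np nc w (i j : 'I_n) : edge nc w (neg i) (pos j) <->
  [/\ (w i + w j).+1 = k,
      forall l : 'I_n, (if nc then i < l else l < i) -> w l <> w i
    & forall l : 'I_n, l < j -> w l <> w j].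
Proof.
rewrite edge_np; last exact: level_equiv.
rewrite level_np; split=> -[/eqP wij H H']; split; rewrite ?wij // => l.
- by move/H; rewrite level_nn eq_sym => /eqP.
- by move/H'; rewrite level_np; lia.
- by move/H; rewrite level_nn eq_sym => /eqP.
- by move/H'; rewrite level_np; lia.
Qed.

Lemma word_edge_nn nc w (i j : 'I_n) : edge nc w (neg i) (neg j) <->
  if nc then edge nc w (pos i) (pos j) else edge nc w (pos j) (pos i).
Proof. by apply: edge_nn; [exact: level_equiv|exact: level_rel_neg]. Qed.

Section Normal.

Variables (m : nat) (w : 'I_n -> nat).
Hypothesis nw : normal k m w.

Lemma nonnesting_fifo : nonnesting (nonzero n) (@nn_lt n) (word_part k w) -> fifo w.
Proof.
have [rng surj ord] := nw.
rewrite -[@nn_lt n]/(@slt false n) => nn x l lx a1 a2 [s0 xs0 ws0].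
have [s [xs ws smin]] := next_occurrence w xs0; rewrite ws0 in ws smin.
rewrite ltnNge; apply/negP; rewrite /key.
move: a1 a2; rewrite /active.
case: (boolP (seen w l x)) => [/lastposP[q [qx wq -> qlast]]|nl];
case: (boolP (seen w (w x) x)) => [/lastposP[p [px wp -> plast]]|nx];
  rewrite ?orbT ?orbF /= => a1 a2 le.
- have qp : q < p.
    by case: (ltngtP q p) => // [|/val_inj qp]; [lia|subst; case: lx; rewrite -wp wq].
  apply: (nn (pos q) (pos p) (pos x) (pos s)); rewrite ?sltE //=.
  split; apply/word_edge_pp; split; rewrite ?wq ?wp //; first by lia.
  move=> z /andP[qz zs] wz; case: (ltngtP z x) => [zx|xz|/val_inj zx].
  + by apply: (qlast z) => //; rewrite qz.
  + by apply: (smin z) => //; rewrite xz.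
  + by subst z; case: lx.
- by have := ltn_ord q; lia.
- have [|i wi] := surj (k - l.+1); first by lia.
  have [i' [_ wi' ni]] := first_occurrence w i.
  apply: (nn (neg i') (pos p) (pos x) (pos s)); rewrite ?sltE //=.
  split; [apply/word_edge_np; split|apply/word_edge_pp; split]; rewrite ?wp //.
  + by lia.
  + move=> z zi wz; case/negP: ni; apply/seenP; exists z => //; lia.
  + rewrite ws => z zs wz; case: (ltngtP z x) => [zx|xz|/val_inj zx].
    * by case/negP: nl; apply/seenP; exists z.
    * by apply: (smin z) => //; rewrite xz.
    * by subst z; case: lx.
- by case/negP: nl; apply: ord; [lia|rewrite a1].
Qed.

(** A violation now makes the edge into the next use [s] of [l] start inside the edge into [x] and
    end beyond it. *)
Lemma noncrossing_lifo : noncrossing (nonzero n) (@nc_lt n) (word_part k w) -> lifo w.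
Proof.
have [rng surj ord] := nw.
rewrite -[@nc_lt n]/(@slt true n) => nc x l lx a1 a2 [s0 xs0 ws0].
have [s [xs ws smin]] := next_occurrence w xs0; rewrite ws0 in ws smin.
rewrite ltnNge; apply/negP; rewrite /key.
have notbtw (q z : 'I_n) : (forall z : 'I_n, q < z < x -> w z <> l) -> q < z < s -> w z <> l.
  move=> qlast /andP[qz zs] wz; case: (ltngtP z x) => [zx|xz|/val_inj zx].
  + by apply: (qlast z) => //; rewrite qz.
  + by apply: (smin z) => //; rewrite xz.
  + by subst z; case: lx.
move: a1 a2; rewrite /active.
case: (boolP (seen w l x)) => [/lastposP[q [qx wq -> qlast]]|nl];
case: (boolP (seen w (w x) x)) => [/lastposP[p [px wp -> plast]]|nx];
  rewrite ?orbT ?orbF /= => a1 a2 le.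
- have pq : p < q.
    have := ltn_ord q.
    by case: (ltngtP p q) => // [|/val_inj qp]; [lia|subst; case: lx; rewrite -wp wq].
  apply: (nc (pos p) (pos q) (pos x) (pos s)); rewrite ?sltE //=.
  split; apply/word_edge_pp; split; rewrite ?wq ?wp //; first by lia.
  by move=> z; apply: notbtw.
- have [|i wi] := surj (k - (w x).+1); first by lia.
  have [i' [_ wi' ni]] := last_occurrence w i.
  apply: (nc (neg i') (pos q) (pos x) (pos s)); rewrite ?sltE //=.
  split; [apply/word_edge_np; split|apply/word_edge_pp; split]; rewrite ?wi' ?wq //.
  + by lia.
  + by move=> z zx wz; case/negP: nx; apply/seenP; exists z.
  + by lia.
  + by move=> z; apply: notbtw.
- by lia.
- by case/negP: nl; apply: ord; [lia|rewrite a1].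
Qed.

Lemma fifo_nonnesting : fifo w -> nonnesting (nonzero n) (@nn_lt n) (word_part k w).
Proof.
have [rng surj ord] := nw; move=> gw.
rewrite -[@nn_lt n]/(@slt false n).
(* Both edges end at positive elements; the other cases reduce to this one by negation. *)
have core (a b : Lambda n) (c d : 'I_n) : slt false a b -> slt false b (pos c) ->
    c < d -> edge false w a (pos d) -> edge false w b (pos c) -> False.
  case: a => [[[] a]|]; last by move=> _ _ _ /(bump_edgeP (level_equiv k w))[].
    case: b => [[[] b]|]; last by move=> _ _ _ _ /(bump_edgeP (level_equiv k w))[].
      rewrite sltE => ba _ cd /word_edge_np[ad na nd] /word_edge_np[bc nb nc].
      (* Opposite labels add up to [k - 1], so [w c < w d] means [w a < w b], and [normal] yields a
         use of [w a] before [b < a]. *)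
      case: (ltngtP (w c) (w d)) => [lt|lt|e]; last by apply: nd e.
        have /seenP[z za wz] : seen w (w a) b by apply: ord; lia.
        by apply: (na z) => //; apply: ltn_trans ba.
      have /seenP[z zc wz] : seen w (w d) c by apply: ord; lia.
      by apply: (nd z) => //; lia.
    move=> _ _ cd /word_edge_np[ad na nd] /word_edge_pp[bc wbc nb].
    have dc : w d <> w c by move=> e; apply: (nd c).
    have sc : seen w (w c) c by apply/seenP; exists b.
    have sd : ~~ seen w (w d) c.
      by apply/negP => /seenP[z zc wz]; apply: (nd z) => //; lia.
    have := gw c (w d) dc; rewrite /active sc orbT (_ : w d < k); last by lia.
    by rewrite /key sc (negPf sd) => /(_ isT isT (ex_intro2 _ _ d cd erefl)) /=; lia.
  case: b => [[[] b]|]; [by rewrite sltE| |by move=> _ _ _ _ /(bump_edgeP (level_equiv k w))[]].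
  rewrite !sltE /= => ab bc cd /word_edge_pp[ad wad na] /word_edge_pp[_ wbc nb].
  have bd : w d <> w c by rewrite -wad -wbc => e; apply: (na b); lia.
  have sc : seen w (w c) c by apply/seenP; exists b.
  have sd : seen w (w d) c by apply/seenP; exists a => //; apply: ltn_trans bc.
  have := gw c (w d) bd; rewrite /active sc sd !orbT => /(_ isT isT).
  rewrite /key sc sd (@lastpos_eq _ _ _ _ b) //; last by move=> z /nb; rewrite wbc.
  rewrite (@lastpos_eq _ _ _ _ a) //; first last.
  - by rewrite -wad => z zz; apply: na; lia.
  - exact: ltn_trans bc.
  by move=> /(_ (ex_intro2 _ _ d cd erefl)); rewrite ltn_add2l; lia.
move=> a b c d ab bc cd [ead ebc].
have [a0 d0 _ _ _] := (bump_edgeP (level_equiv k w) _ _ _).1 ead.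
have [b0 c0 _ _ _] := (bump_edgeP (level_equiv k w) _ _ _).1 ebc.
case: d d0 cd ead => // -[[] d] _ cd ead; case: c c0 bc cd ebc => // -[[] c] _ bc cd ebc;
  move: cd; rewrite sltE //= => cd; last exact: (core a b c d).
  case: b b0 bc ab ebc => // -[[] b] _; rewrite sltE //= => bc ab ebc.
  case: a a0 ab ead => // -[[] a] _; rewrite sltE //= => ab ead.
  apply: (core (pos d) (pos c) b a); rewrite ?sltE //=.
    exact: (word_edge_nn false w a d).1.
  exact: (word_edge_nn false w b c).1.
case: b b0 bc ab ebc => // -[[] b] _; rewrite sltE //= => bc ab ebc.
case: a a0 ab ead => // -[[] a] _; rewrite sltE //= => ab ead.
(* The description of edges from negative to positive is symmetric in this order, so
   [(neg d, pos a)] is an edge as well. *)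
apply: (core (neg d) (pos c) b a); rewrite ?sltE //=.
  by apply/word_edge_np; have /word_edge_np[e1 e2 e3] := ead; split=> //; lia.
exact: (word_edge_nn false w b c).1.
Qed.

Lemma lifo_noncrossing : lifo w -> noncrossing (nonzero n) (@nc_lt n) (word_part k w).
Proof.
have [rng surj ord] := nw; move=> gw.
rewrite -[@nc_lt n]/(@slt true n).
(* Stack property: at the next use of [l] after [i], the label [w i] has been used more recently
   than [l] and has uses left, so it should be served first. *)
have cross l (i r s : 'I_n) : active k w l i -> w i <> l -> i < r -> w r = l -> r < s ->
    w s = w i -> False.
  move=> al il ir wr rs ws; have [r' [ir' wr' nr']] := next_occurrence w ir.
  rewrite wr in wr' nr'.
  have rr : r' <= r by rewrite leqNgt; apply/negP => rr; apply: (nr' r) => //; rewrite ir.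
  have sc : seen w (w i) r' by apply/seenP; exists i.
  have := gw r' (w i); rewrite wr' {2}/active sc orbT (active_mono (ltnW ir') al).
  move=> /(_ il isT isT (ex_intro2 _ _ s (leq_ltn_trans rr rs) ws)).
  have [q [qr wq elast qlast]] := lastposP sc.
  have iq : i <= q by rewrite leqNgt; apply/negP => qi; apply: (qlast i) => //; rewrite qi.
  rewrite /key sc elast; case: ifP => [/lastposP[p [pr wp -> plast]]|_]; last by lia.
  have pi : p < i.
    case: (ltngtP p i) => // [ip|/val_inj e]; last by case: il; rewrite -e.
    by case: (nr' p) => //; rewrite ip.
  by have := ltn_ord q; lia.
have act l x : l < k -> active k w l x by rewrite /active => ->.
have core (a b : Lambda n) (c d : 'I_n) : slt true a b -> slt true b (pos c) ->
    c < d -> edge true w a (pos c) -> edge true w b (pos d) -> False.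
  case: a => [[[] a]|]; last by move=> _ _ _ /(bump_edgeP (level_equiv k w))[].
    case: b => [[[] b]|]; last by move=> _ _ _ _ /(bump_edgeP (level_equiv k w))[].
      rewrite sltE => ab _ cd /word_edge_np[ac na nc] /word_edge_np[bd nb nd].
      (* If [w c < w d] then [w b < w a], so [w b] is used before the first use [y] of [w a], and
         again at [b > a]. *)
      case: (ltngtP (w c) (w d)) => [lt|lt|e]; last by apply: nd e.
        have [y [ya wy ny]] := first_occurrence w a.
        have /seenP[z zy wz] : seen w (w b) y by apply: ord; lia.
        by apply: (cross (w a) z y b) => //; [apply: act| |]; lia.
      have /seenP[z zc wz] : seen w (w d) c by apply: ord; lia.
      by apply: (nd z) => //; lia.
    rewrite !sltE /= => _ bc cd /word_edge_np[ac na nc] /word_edge_pp[bd wbd nb].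
    by apply: (cross (w c) b c d) => //; [apply: act; lia|apply: nc].
  case: b => [[[] b]|]; [by rewrite sltE| |by move=> _ _ _ _ /(bump_edgeP (level_equiv k w))[]].
  rewrite !sltE /= => ab bc cd /word_edge_pp[ac wac na] /word_edge_pp[bd wbd nb].
  apply: (cross (w c) b c d) => //.
    by apply/orP; right; apply/seenP; exists a.
  by rewrite -wac; apply: na; rewrite ab.
move=> a b c d ab bc cd [eac ebd].
have [a0 c0 _ _ _] := (bump_edgeP (level_equiv k w) _ _ _).1 eac.
have [b0 d0 _ _ _] := (bump_edgeP (level_equiv k w) _ _ _).1 ebd.
case: d d0 cd ebd => // -[[] d] _ cd ebd; case: c c0 bc cd eac => // -[[] c] _ bc cd eac;
  move: cd; rewrite sltE //= => cd; last exact: (core a b c d).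
  case: b b0 bc ab ebd => // -[[] b] _; rewrite sltE //= => bc ab ebd.
  case: a a0 ab eac => // -[[] a] _; rewrite sltE //= => ab eac.
  apply: (core (pos a) (pos b) c d); rewrite ?sltE //=.
    exact: (word_edge_nn true w a c).1.
  exact: (word_edge_nn true w b d).1.
case: b b0 bc ab ebd => // -[[] b] _; rewrite sltE //= => bc ab ebd.
case: a a0 ab eac => // -[[] a] _; rewrite sltE //= => ab eac.
have /word_edge_pp[ac wac na] := (word_edge_nn true w a c).1 eac.
have /word_edge_np[bd nb nd] := ebd.
(* The label of [b] is switching, hence active from the start, and it is used between the two uses
   [a] and [c] of another label. *)
by apply: (cross (w b) a b c) => //; [apply: act; lia|apply/nesym/na; rewrite ab].
Qed.

End Normal.

End Discipline.

(** * Every nonnesting or noncrossing partition comes from a word *)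

Section Presentation.

Variables (n : nat) (E : rel (Lambda n)).
Hypothesis eqE : equivalence_rel E.
Hypothesis Eneg : forall s t, E (lneg s) (lneg t) = E s t.
Hypothesis Ezero : forall s, E s (lneg s) -> E s None.

Local Notation cls s := [set t | E s t].

Definition opp (B : {set Lambda n}) : {set Lambda n} := [set s | lneg s \in B].

Definition leading (i : 'I_n) := forall l : 'I_n, l < i -> ~~ E (pos i) (pos l).

Lemma equiv_np i j : E (neg i) (pos j) = E (pos i) (neg j).
Proof. by rewrite -Eneg. Qed.

Lemma equiv_nn i j : E (neg i) (neg j) = E (pos i) (pos j).
Proof. by rewrite -Eneg. Qed.

Lemma opp_cls s : opp (cls s) = cls (lneg s).
Proof. by apply/setP => t; rewrite !inE -Eneg lnegK. Qed.

Lemma oppK (B : {set Lambda n}) : opp (opp B) = B.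
Proof. by apply/setP => t; rewrite !inE lnegK. Qed.

Lemma switchingP i : reflect (exists j, E (pos i) (neg j)) (switching (cls (pos i))).
Proof.
apply: (iffP andP) => [[_ /existsP[s /andP[]]]|[j ij]].
  rewrite inE leNgt lval_gt0; case: s => [[[] j]|] //= es _; first by exists j.
  exists i; rewrite (equiv_left eqE es) (equiv_sym eqE).
  by rewrite -Eneg.
split; apply/existsP.
  by exists (pos i); rewrite inE lval_gt0 equiv_refl.
by exists (neg j); rewrite inE leNgt lval_gt0 ij.
Qed.

Lemma nonswitching_cls i : pos_nonswitching (cls (pos i)) = ~~ switching (cls (pos i)).
Proof. by apply: (@nonswitchingE _ _ i); rewrite inE equiv_refl. Qed.

Lemma leading_minpos i : leading i -> minpos (cls (pos i)) = i.+1.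
Proof.
move=> li; apply: minpos_eq => [|j /li]; first by rewrite inE equiv_refl.
by rewrite inE.
Qed.

Lemma leading_exists (i : 'I_n) : exists j : 'I_n, [/\ j <= i, E (pos i) (pos j) & leading j].
Proof.
have iB : pos i \in cls (pos i) by rewrite inE equiv_refl.
have [j [ji]] := minposP iB; rewrite inE => ej _ nj; exists j; split=> // l /nj.
by rewrite inE (equiv_left eqE ej).
Qed.

Lemma switching_leading B : B \in epart E -> switching B -> exists i j,
  [/\ leading i, leading j, B = cls (pos i), opp B = cls (pos j) & E (neg j) (pos i)].
Proof.
move=> BP sB; have [i0 i0B] := switching_pos sB.
have eB := mem_cls eqE BP i0B; rewrite eB in sB.
have [j0 ej0] := switchingP i0 sB.
have [i [_ ei li]] := leading_exists i0; have [j [_ ej lj]] := leading_exists j0.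
have eji : E (neg j) (pos i).
  apply: (equiv_trans eqE) ei; rewrite (equiv_sym eqE).
  by apply: (equiv_trans eqE) ej0 _; rewrite equiv_nn.
exists i, j; split=> //; first by rewrite eB; apply/eqP; rewrite cls_eq.
rewrite eB opp_cls; apply/eqP; rewrite cls_eq //=.
by apply: (equiv_trans eqE) ej; rewrite equiv_np.
Qed.

(** Opposite blocks are joined by an edge from the negative of a least element to a least element;
    two such edges nest unless the order reverses. *)
Lemma nonnesting_antitone : nonnesting (nonzero n) (@nn_lt n) (epart E) ->
  forall i j i' j' : 'I_n, leading i -> leading j -> leading i' -> leading j' ->
  E (neg j) (pos i) -> E (neg j') (pos i') -> i < i' -> j' < j.
Proof.
rewrite -[@nn_lt n]/(@slt false n) => nn i j i' j' li lj li' lj' ij ij' ii'.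
have edge a b : leading a -> leading b -> E (neg b) (pos a) ->
    bump_edge (nonzero n) (@slt false n) (epart E) (neg b) (pos a).
  move=> la lb ab; apply/(edge_np eqE); split=> // l.
    by rewrite equiv_nn; apply: lb.
  by move/la; rewrite (equiv_left eqE ab).
case: (ltngtP j' j) => // [jj|/val_inj jj].
  case: (nn (neg j') (neg j) (pos i) (pos i')); rewrite ?sltE //.
  by split; apply: edge.
have := li' _ ii'; rewrite (equiv_sym eqE); subst j'.
by rewrite -(equiv_left eqE ij) ij'.
Qed.

(** The joining edges now start at negatives of largest elements, so passing to least elements takes
    a second crossing. *)
Lemma noncrossing_antitone : noncrossing (nonzero n) (@nc_lt n) (epart E) ->
  forall i j i' j' : 'I_n, leading i -> leading j -> leading i' -> leading j' ->
  E (neg j) (pos i) -> E (neg j') (pos i') -> i < i' -> j' < j.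
Proof.
rewrite -[@nc_lt n]/(@slt true n) => nc i j i' j' li lj li' lj' ij ij' ii'.
have last (b : 'I_n) : exists c : 'I_n, [/\ b <= c, E (pos b) (pos c)
    & forall l : 'I_n, c < l -> ~~ E (pos b) (pos l)].
  have [c ec cmax] := @arg_maxnP _ b (fun c => E (pos b) (pos c)) (@nat_of_ord n)
    (equiv_refl eqE _).
  exists c; split=> //; first by apply: cmax; apply: equiv_refl.
  by move=> l cl; apply/negP => /cmax; lia.
have edge (a b c : 'I_n) : leading a -> E (neg b) (pos a) -> E (pos b) (pos c) ->
    (forall l : 'I_n, c < l -> ~~ E (pos b) (pos l)) ->
    bump_edge (nonzero n) (@slt true n) (epart E) (neg c) (pos a).
  move=> la ab bc lc; have bc' : E (neg b) (neg c) by rewrite equiv_nn.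
  apply/(edge_np eqE); rewrite -(equiv_left eqE bc'); split=> // l.
    by rewrite -(equiv_left eqE bc') equiv_nn; apply: lc.
  by rewrite -(equiv_left eqE bc') (equiv_left eqE ab); apply: la.
have neq : ~~ E (pos j) (pos j').
  rewrite -equiv_nn; apply/negP => ejj; have := li' _ ii'.
  by rewrite (equiv_sym eqE) -(equiv_left eqE ij) (equiv_left eqE ejj) ij'.
case: (ltngtP j' j) => // [jj|/val_inj jj]; last by rewrite jj equiv_refl in neq.
have [J [jJ eJ nJ]] := last j; have [J' [jJ' eJ' nJ']] := last j'.
have [I' [iI' eI' nI']] := last i'.
(* Otherwise the edges [(neg J, pos i)] and [(neg J', pos i')] cross. *)
have JJ : J' < J.
  case: (ltngtP J' J) => // [JJ|/val_inj JJ].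
    case: (nc (neg J) (neg J') (pos i) (pos i')); rewrite ?sltE //.
    by split; [apply: edge eJ nJ|apply: edge eJ' nJ'].
  by move: neq; rewrite (equiv_left eqE eJ) (equiv_sym eqE) -JJ eJ'.
(* As [j < j' < J], the block of [j] has an edge from [y] to [z] passing over [j'], and it crosses
   the edge [(neg I', pos j')]. *)
have pj : (j < j') && E (pos j) (pos j) by rewrite jj equiv_refl.
have [y /andP[yj ey] ymax] := @arg_maxnP _ j
  (fun y : 'I_n => (y < j') && E (pos j) (pos y)) (@nat_of_ord n) pj.
have pJ : (j' < J) && E (pos j) (pos J) by rewrite eJ andbT; lia.
have [z /andP[zj ez] zmin] := @arg_minnP _ J
  (fun y : 'I_n => (j' < y) && E (pos j) (pos y)) (@nat_of_ord n) pJ.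
case: (nc (neg I') (pos y) (pos j') (pos z)); rewrite ?sltE //; split.
  by apply: edge lj' _ eI' nI'; rewrite equiv_np (equiv_sym eqE).
apply/(edge_pp eqE); rewrite -!(equiv_left eqE ey); split=> //; first by lia.
move=> l /andP[yl lz]; rewrite -!(equiv_left eqE ey); apply/negP => el.
case: (ltngtP l j') => [lj2|lj2|/val_inj lj2].
- by have := ymax l; rewrite lj2 el => /(_ isT); lia.
- by have := zmin l; rewrite lj2 el => /(_ isT); lia.
- by move: neq; rewrite -lj2 el.
Qed.

Hypothesis antitone : forall i j i' j' : 'I_n, leading i -> leading j -> leading i' -> leading j' ->
  E (neg j) (pos i) -> E (neg j') (pos i') -> i < i' -> j' < j.

Let Sw := blocks_by_minpos (epart E) (@switching n).
Let Ns := blocks_by_minpos (epart E) (@pos_nonswitching n).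
Let k := size Sw.

Lemma sortedS : sorted ltn [seq minpos B | B <- Sw].
Proof. by apply: blocks_sorted => // B _ /switching_pos. Qed.

Lemma sortedN : sorted ltn [seq minpos B | B <- Ns].
Proof. exact: blocks_sorted eqE _ (nonswitching_pos eqE). Qed.

Lemma minpos_sorted_uniq (s : seq {set Lambda n}) :
  sorted ltn [seq minpos B | B <- s] -> uniq s.
Proof.
by rewrite ltn_sorted_uniq_leq => /andP[/map_uniq].
Qed.

(** Negation permutes the switching blocks and, by [antitone], reverses their order; hence the
    opposite of label [l] is [k - 1 - l]. *)
Lemma opp_rev : rev [seq opp B | B <- Sw] = Sw.
Proof.
have data B : B \in Sw -> exists i j, [/\ leading i, leading j, B = cls (pos i),
    opp B = cls (pos j) & E (neg j) (pos i)].
  by rewrite mem_blocks => /andP[]; apply: switching_leading.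
have oppS B : B \in Sw -> opp B \in Sw.
  move=> /data[i [j [li lj _ -> ij]]]; rewrite mem_blocks; apply/andP; split.
    by apply/mem_epart; exists (pos j).
  by apply/switchingP; exists i; rewrite -equiv_np.
apply: minpos_inj_list; last 1 first.
- move=> B; rewrite mem_rev; apply/mapP/idP => [[C CS ->]|BS]; first exact: oppS.
  by exists (opp B); [apply: oppS|rewrite oppK].
- rewrite map_rev rev_sorted -map_comp sorted_map.
  have := sortedS; rewrite sorted_map; apply: sub_in_sorted (allss _) => B C.
  move=> /data[i [j [li lj eB oB ij]]] /data[i' [j' [li' lj' eC oC ij']]] /=.
  rewrite oB oC eB eC (leading_minpos li) (leading_minpos li').
  rewrite (leading_minpos lj) (leading_minpos lj').
  exact: (antitone li lj li' lj').
- exact: sortedS.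
Qed.

Definition word (i : 'I_n) : nat :=
  if switching (cls (pos i)) then index (cls (pos i)) Sw
  else k + index (cls (pos i)) Ns.

Lemma cls_in s : cls s \in epart E. Proof. by apply/mem_epart; exists s. Qed.

Lemma mem_switching i : switching (cls (pos i)) -> cls (pos i) \in Sw.
Proof. by rewrite mem_blocks cls_in => ->. Qed.

Lemma mem_nonswitching i : ~~ switching (cls (pos i)) -> cls (pos i) \in Ns.
Proof. by rewrite mem_blocks cls_in nonswitching_cls => ->. Qed.

Lemma word_lt i : (word i < k) = switching (cls (pos i)).
Proof.
rewrite /word; case: ifP => [sw|_]; last by lia.
by rewrite index_mem mem_switching.
Qed.

Lemma word_pp i j : E (pos i) (pos j) = (word i == word j).
Proof.
rewrite -(cls_eq eqE); apply/eqP/eqP => [e|]; first by rewrite /word e.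
have := word_lt i; have := word_lt j; rewrite /word.
case: ifP => [swj|/negbT swj]; case: ifP => [swi|/negbT swi].
- move=> _ _ e; rewrite -[LHS](nth_index finset.set0 (mem_switching swi)) e.
  by rewrite nth_index ?mem_switching.
- by lia.
- by lia.
- move=> _ _ /addnI e; rewrite -[LHS](nth_index finset.set0 (mem_nonswitching swi)) e.
  by rewrite nth_index ?mem_nonswitching.
Qed.

Lemma switching_pn i j : E (pos i) (neg j) ->
  switching (cls (pos i)) && switching (cls (pos j)).
Proof.
move=> ij; apply/andP; split; apply/switchingP; first by exists j.
by exists i; rewrite (equiv_sym eqE) equiv_np.
Qed.

Lemma word_pn i j : E (pos i) (neg j) = ((word i + word j).+1 == k).
Proof.
case: (boolP (switching (cls (pos i)) && switching (cls (pos j)))) => [/andP[si sj]|ns]; last first.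
  rewrite (contraNF (@switching_pn i j) ns); move: ns; rewrite -!word_lt; lia.
have li : word i < k by rewrite word_lt.
have lj : word j < k by rewrite word_lt.
rewrite -equiv_np -(cls_eq eqE) -[neg i]/(lneg (pos i)) -opp_cls.
have eS l : switching (cls (pos l)) -> nth finset.set0 Sw (word l) = cls (pos l).
  by move=> sl; rewrite /word sl nth_index ?mem_switching.
rewrite -(eS i si) -(eS j sj) -[X in opp (nth _ X _)]opp_rev nth_rev ?size_map //.
rewrite (nth_map finset.set0); last by rewrite -/k; lia.
rewrite oppK nth_uniq -/k //; [lia|lia|].
exact: minpos_sorted_uniq sortedS.
Qed.

Lemma word_normal : normal k (size Ns) word.
Proof.
have uS := minpos_sorted_uniq sortedS; have uN := minpos_sorted_uniq sortedN.
have earlier (X : seq {set Lambda n}) l (j : 'I_n) :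
    sorted ltn [seq minpos B | B <- X] -> cls (pos j) \in X -> {subset X <= epart E} ->
    (forall B, B \in X -> exists i, pos i \in B) -> l < index (cls (pos j)) X ->
    exists2 i : 'I_n, i < j & nth finset.set0 X l = cls (pos i).
  move=> sX jX XP Xpos lj; have jX' := jX; rewrite -index_mem in jX'.
  have lX : nth finset.set0 X l \in X by rewrite mem_nth //; lia.
  have [i0 /minposP[i [_ iB mi _]]] := Xpos _ lX.
  exists i; last exact: mem_cls (XP _ lX) iB.
  have jj : pos j \in cls (pos j) by rewrite inE equiv_refl.
  have [j' [j'j _ mj _]] := minposP jj.
  have := @sorted_ltn_nth _ ltn ltn_trans 0 _ sX l (index (cls (pos j)) X).
  rewrite !inE !size_map jX' (ltn_trans lj jX') => /(_ isT isT lj).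
  by rewrite !(nth_map finset.set0) ?(ltn_trans lj jX') // nth_index // mi mj; lia.
have Spos B : B \in Sw -> exists i, pos i \in B.
  by rewrite mem_blocks => /andP[_ /switching_pos].
have Npos B : B \in Ns -> exists i, pos i \in B.
  by rewrite mem_blocks => /andP[]; apply: nonswitching_pos eqE _.
have SP : {subset Sw <= epart E} by move=> B; rewrite mem_blocks => /andP[].
have NP : {subset Ns <= epart E} by move=> B; rewrite mem_blocks => /andP[].
have wS l i : l < k -> nth finset.set0 Sw l = cls (pos i) -> word i = l.
  move=> lk e; have : cls (pos i) \in Sw by rewrite -e mem_nth.
  by rewrite mem_blocks /word => /andP[_ ->]; rewrite -e index_uniq.
have wN l i : l < size Ns -> nth finset.set0 Ns l = cls (pos i) -> word i = k + l.
  move=> lk e; have : cls (pos i) \in Ns by rewrite -e mem_nth.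
  rewrite mem_blocks nonswitching_cls /word => /andP[_ /negPf->].
  by rewrite -e index_uniq.
split.
- move=> i; rewrite /word; case: ifP => [sw|/negbT sw].
    by apply: ltn_addr; rewrite index_mem mem_switching.
  by rewrite ltn_add2l index_mem mem_nonswitching.
- move=> l lkm; case: (ltnP l k) => lk.
    have lS : nth finset.set0 Sw l \in Sw by rewrite mem_nth.
    have [i iB] := Spos _ lS; exists i; apply: wS => //; exact: mem_cls (SP _ lS) iB.
  have lkN : l - k < size Ns by rewrite -(ltn_add2l k) subnKC.
  have lN : nth finset.set0 Ns (l - k) \in Ns by rewrite mem_nth.
  have [i iB] := Npos _ lN; exists i.
  have -> : word i = k + (l - k); last by rewrite subnKC.
  by apply: wN => //; exact: mem_cls (NP _ lN) iB.
move=> l j; rewrite word_lt {1}/word; case: ifP => [sw lj _|/negbT sw lj /= kl].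
  have lk : l < k by apply: ltn_trans lj _; rewrite index_mem mem_switching.
  have [i ij /(wS _ _ lk) wi] := earlier _ _ _ sortedS (mem_switching sw) SP Spos lj.
  by apply/seenP; exists i.
have lj' : l - k < index (cls (pos j)) Ns.
  by rewrite -(ltn_add2l k) subnKC //; move: kl; rewrite (negPf sw).
have jN := mem_nonswitching sw; have jN' := jN; rewrite -index_mem in jN'.
have [i ij /(wN _ _ (ltn_trans lj' jN')) wi] := earlier _ _ _ sortedN jN NP Npos lj'.
by apply/seenP; exists i => //; rewrite wi subnKC //; move: kl; rewrite (negPf sw).
Qed.

(** By [Ezero] a positive element is in the zero block exactly when it is equivalent to its own
    negative, which the labels detect. *)
Lemma word_rel : E =2 level_rel k word.
Proof.
have zero i : E (pos i) None = level_rel k word (pos i) None.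
  have -> : E (pos i) None = E (pos i) (neg i).
    apply/idP/idP => [e|/Ezero //]; apply: (equiv_trans eqE e).
    by rewrite (equiv_sym eqE) -Eneg.
  by rewrite word_pn -code_opp /level_rel /=; lia.
have symL := equiv_sym (level_equiv k word).
case=> [[[] i]|] [[[] j]|].
- by rewrite equiv_nn level_nn word_pp.
- by rewrite equiv_np level_np word_pn.
- by rewrite -Eneg -level_rel_neg zero.
- by rewrite level_pn word_pn.
- by rewrite level_pp word_pp.
- exact: zero.
- by rewrite (equiv_sym eqE) symL -Eneg -level_rel_neg zero.
- by rewrite (equiv_sym eqE) symL zero.
- by rewrite (equiv_refl eqE) /level_rel eqxx.
Qed.

End Presentation.

Lemma presentation n (E : rel (Lambda n)) : equivalence_rel E ->
  (forall s t, E (lneg s) (lneg t) = E s t) -> (forall s, E s (lneg s) -> E s None) ->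
  nonnesting (nonzero n) (@nn_lt n) (epart E) \/
    noncrossing (nonzero n) (@nc_lt n) (epart E) ->
  exists k m w, normal k m w /\ E =2 level_rel k w.
Proof.
move=> eqE Eneg Ezero H.
have anti : forall i j i' j' : 'I_n, leading E i -> leading E j -> leading E i' ->
    leading E j' -> E (neg j) (pos i) -> E (neg j') (pos i') -> i < i' -> j' < j.
  by case: H; [apply: nonnesting_antitone|apply: noncrossing_antitone].
by do 3 eexists; split; [exact: word_normal|exact: word_rel].
Qed.

(** * Classical subspaces *)

Section Subspaces.

Variables (R : realType) (n : nat).
Implicit Types (L : set 'rV[R]_n) (x : 'rV[R]_n).

Definition coord_rel L : rel (Lambda n) :=
  fun s t => `[< forall x, L x -> lcoord x s = lcoord x t >].

Definition solutions (E : rel (Lambda n)) : set 'rV[R]_n :=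
  fun x => forall s t, E s t -> lcoord x s = lcoord x t.

Lemma lcoord_lneg x s : lcoord x (lneg s) = (- lcoord x s)%R.
Proof.
by case: s => [[[] i]|] /=; rewrite ?expr1 ?expr0 ?mulN1r ?mul1r ?opprK ?oppr0.
Qed.

Lemma coord_rel_equiv L : equivalence_rel (coord_rel L).
Proof.
move=> s t u; split=> [|/asboolP st]; first by apply/asboolP.
by apply/asboolP/asboolP => H x Lx; rewrite -(H x Lx) st.
Qed.

Lemma coord_rel_neg L s t : coord_rel L (lneg s) (lneg t) = coord_rel L s t.
Proof.
apply/asboolP/asboolP => H x Lx; last by rewrite !lcoord_lneg H.
by apply: oppr_inj; rewrite -!lcoord_lneg H.
Qed.

Lemma coord_rel_zero L s : coord_rel L s (lneg s) -> coord_rel L s None.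
Proof.
move=> /asboolP H; apply/asboolP => x /H; rewrite lcoord_lneg => /eqP.
by rewrite -addr_eq0 -mulr2n mulrn_eq0 => /eqP.
Qed.

(** Each hyperplane of the family is an equation between coordinates valid on [L], hence an instance
    of [coord_rel L]. *)
Lemma classical_subspaceE L : classical_subspace L -> L = solutions (coord_rel L).
Proof.
case=> HH [hyp eL]; apply/seteqP; split=> [x Lx s t /asboolP|x sx]; first exact.
rewrite {1}eL => H HHH.
have sub y : L y -> H y by rewrite eL; apply.
have lc (b : bool) i : lcoord x (Some (b, i)) = ((-1) ^+ b * x ord0 i)%R by [].
case: (hyp _ HHH) sub => [i j _|i j _|i] /= sub.
- have := sx (pos i) (pos j); rewrite !lc !mul1r; apply; apply/asboolP => y /sub.
  by rewrite /= !mul1r.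
- have := sx (pos i) (neg j); rewrite !lc mul1r mulN1r; apply; apply/asboolP => y /sub.
  by rewrite /= mul1r mulN1r.
- have := sx (pos i) None; rewrite !lc !mul1r; apply; apply/asboolP => y /sub.
  by rewrite /= mul1r.
Qed.

Lemma solutions_classical E : (forall s t, E (lneg s) (lneg t) = E s t) ->
  classical_subspace (solutions E).
Proof.
move=> Eneg.
exists (fun H => hyperplane H /\ (solutions E `<=` H)%classic); split; first by move=> H [].
apply/seteqP; split=> [x sx H [_]|x sx]; first exact.
have half (y : 'rV[R]_n) i : (y ord0 i = - y ord0 i)%R -> y ord0 i = 0%R.
  by move/eqP; rewrite -addr_eq0 -mulr2n mulrn_eq0 => /eqP.
have zero i : (forall y, solutions E y -> y ord0 i = 0%R) -> x ord0 i = 0%R.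
  by move=> H; apply: (sx _ (conj (Hyp_zero _ i) H)).
have lp (y : 'rV[R]_n) i : lcoord y (pos i) = y ord0 i by rewrite /= mul1r.
have ln (y : 'rV[R]_n) i : lcoord y (neg i) = (- y ord0 i)%R by rewrite /= mulN1r.
have l0 (y : 'rV[R]_n) : lcoord y None = 0%R by [].
have pp i j : E (pos i) (pos j) -> x ord0 i = x ord0 j.
  move=> e; case: (eqVneq i j) => [->//|ij].
  by apply: (sx _ (conj (Hyp_eq _ ij) _)) => y /(_ _ _ e); rewrite !lp.
have pn i j : E (pos i) (neg j) -> (x ord0 i = - x ord0 j)%R.
  move=> e; case: (eqVneq i j) e => [->|ij] e.
    (* For [i = j] the relation reads [x_i = - x_i], that is [x_i = 0]. *)
    rewrite zero ?oppr0 // => y /(_ _ _ e); rewrite lp ln; exact: half.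
  by apply: (sx _ (conj (Hyp_opp _ ij) _)) => y /(_ _ _ e); rewrite lp ln.
move=> [[[] i]|] [[[] j]|] e; rewrite ?lp ?ln ?l0 //.
- by rewrite (pp i j) // -Eneg.
- by rewrite (pn i j) ?opprK // -Eneg.
- by rewrite zero ?oppr0 // => y /(_ _ _ e); rewrite ln l0 => /eqP; rewrite oppr_eq0 => /eqP.
- exact: pn.
- exact: pp.
- by apply: zero => y /(_ _ _ e); rewrite lp l0.
- by rewrite zero ?oppr0 // => y /(_ _ _ e); rewrite ln l0 => /esym/eqP; rewrite oppr_eq0 => /eqP.
- by apply/esym/zero => y /(_ _ _ e); rewrite lp l0.
Qed.

Lemma level_rel_solutions k w : coord_rel (solutions (level_rel k w)) =2 level_rel k w.
Proof.
move=> s t; apply/asboolP/idP => [H|st x]; last exact.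
(* The vector of codes is a solution whose coordinates agree only where the levels do, so no further
   relation is forced. *)
have generic u : lcoord (\row_i (code k (w i))%:~R : 'rV[R]_n)%R u = ((level k w u)%:~R)%R.
  by case: u => [[[] i]|] //=; rewrite ?mxE ?expr1 ?expr0 ?mulN1r ?mul1r ?mulrNz.
have := H (\row_i (code k (w i))%:~R)%R; rewrite !generic => e.
by rewrite /level_rel -(eqr_int R); apply/eqP/e => u v /eqP uv; rewrite !generic uv.
Qed.

Lemma word_part_classical k (w : 'I_n -> nat) : classical_partition R (word_part k w).
Proof.
exists (solutions (level_rel k w)); split.
  by apply: solutions_classical => s t; rewrite level_rel_neg.
by apply: eq_epart => s t; rewrite -[RHS]/(coord_rel _ s t) level_rel_solutions.
Qed.

Lemma subspace_presentation L :
  nonnesting (nonzero n) (@nn_lt n) (Part L) \/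
    noncrossing (nonzero n) (@nc_lt n) (Part L) ->
  exists k m w, normal k m w /\ coord_rel L =2 level_rel k w.
Proof.
by apply: presentation (coord_rel_equiv L) (@coord_rel_neg L) (@coord_rel_zero L).
Qed.

Lemma classical_presentation (P : {set {set Lambda n}}) : classical_partition R P ->
  nonnesting (nonzero n) (@nn_lt n) P \/ noncrossing (nonzero n) (@nc_lt n) P ->
  exists k m w, normal k m w /\ P = word_part k w.
Proof.
move=> [L [_ ->]] /subspace_presentation[k [m [w [nw e]]]].
by exists k, m, w; split=> //; apply: eq_epart.
Qed.

Definition lperm (sigma : 'S_n) (s : Lambda n) : Lambda n :=
  if s is Some (b, i) then Some (b, sigma i) else None.

Lemma lcoord_signed_perm (sigma : 'S_n) x s :
  lcoord (signed_perm sigma [ffun=> false] x) s = lcoord x (lperm sigma s).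
Proof. by case: s => [[b i]|] //=; rewrite mxE ffunE expr0 mul1r. Qed.

Lemma signed_perm_comp (sigma tau : 'S_n) eps x :
  signed_perm tau eps (signed_perm sigma [ffun=> false] x) =
  signed_perm (tau * sigma)%g eps x.
Proof. by apply/rowP => i; rewrite !mxE ffunE expr0 mul1r permM. Qed.

Lemma solutions_perm k (w w' : 'I_n -> nat) (sigma : 'S_n) :
  (forall i, w' i = w (sigma i)) ->
  solutions (level_rel k w') =
    (signed_perm sigma [ffun=> false] @` solutions (level_rel k w))%classic.
Proof.
move=> ww'.
have lvl s : level k w' s = level k w (lperm sigma s).
  by case: s => [[b i]|] //=; rewrite ww'.
have lpermK s : lperm sigma (lperm sigma^-1 s) = s.
  by case: s => [[b i]|] //=; rewrite permKV.
apply/seteqP; split=> [x sx|_ [x sx <-]].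
  exists (signed_perm sigma^-1 [ffun=> false] x).
    move=> s t e; rewrite !lcoord_signed_perm; apply: sx.
    by rewrite /level_rel !lvl !lpermK.
  apply/rowP => i; rewrite signed_perm_comp mulgV mxE ffunE.
  by rewrite expr0 mul1r perm1.
move=> s t e; rewrite !lcoord_signed_perm; apply: sx.
by rewrite /level_rel -!lvl.
Qed.

(** The reverse inclusion comes from the inverse permutation. *)
Lemma subspace_type_sub L (sigma : 'S_n) :
  (subspace_type (signed_perm sigma [ffun=> false] @` L) `<=` subspace_type L)%classic.
Proof.
move=> _ [tau [eps ->]]; exists (tau * sigma)%g, eps.
by rewrite image_comp; apply: eq_imagel => x _ /=; rewrite signed_perm_comp.
Qed.

End Subspaces.

(** * The correspondence and the equality of types *)

Lemma equinumerous_perm n (w w' : 'I_n -> nat) :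
  (forall l, #|[set i | w i == l]| = #|[set i | w' i == l]|) ->
  exists sigma : 'S_n, forall i, w' i = w (sigma i).
Proof.
move=> cnt.
have cE (v : 'I_n -> nat) l : count_mem l [tuple v i | i < n] = #|[set i | v i == l]|.
  rewrite /= count_map -sum1_count big_enum_cond -sum1dep_card.
  by apply: eq_bigl => i; rewrite inE.
have : perm_eq [tuple w' i | i < n] [tuple w i | i < n].
  by apply/allP => l _ /=; rewrite !cE cnt.
case/tuple_permP => sigma e; exists sigma => i.
have /(congr1 (fun t => tnth t i)) : [tuple w' i | i < n] =
    [tuple tnth [tuple w i | i < n] (sigma i) | i < n] by apply: val_inj.
by rewrite !tnth_mktuple.
Qed.

Lemma fifo_companion n k m (w : 'I_n -> nat) : normal k m w ->
  exists w', [/\ normal k m w', similar k w w' & fifo k w'].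
Proof.
move=> nw; have [||l y|w' sw gw] := @greedy_exists n k id (addn k) _ _ _ w => //.
- by move=> y y' _ _ /addnI.
- by move=> /=; lia.
exists w'; split=> //; apply: similar_normal nw sw _.
by apply: greedy_ord gw.
Qed.

Lemma lifo_companion n k m (w : 'I_n -> nat) : normal k m w ->
  exists w', [/\ normal k m w', similar k w w' & lifo k w'].
Proof.
move=> nw.
have [|||w' sw gw] := @greedy_exists n k (fun l => (n + l).+1) (fun y => n - y) _ _ _ w.
- by move=> l l'; lia.
- by move=> l l'; lia.
- by move=> l l'; lia.
exists w'; split=> //; apply: similar_normal nw sw _.
by apply: greedy_ord gw => l l'; lia.
Qed.

Theorem theorem2p7 (R : realType) (n : nat) :
  (forall P : {set {set Lambda n}}, classical_noncrossing R P ->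
     exists! P' : {set {set Lambda n}},
       classical_nonnesting R P' /\ same_stats P P') /\
  (forall P' : {set {set Lambda n}}, classical_nonnesting R P' ->
     exists! P : {set {set Lambda n}},
       classical_noncrossing R P /\ same_stats P P') /\
  (forall L L' : set 'rV[R]_n,
     classical_subspace L -> classical_subspace L' ->
     classical_noncrossing R (Part L) -> classical_nonnesting R (Part L') ->
     same_stats (Part L) (Part L') ->
     subspace_type L = subspace_type L').
Proof.
have sym (P P' : {set {set Lambda n}}) : same_stats P P' -> same_stats P' P.
  by case.
split; last split.
- move=> P [cP nc]; have [|k [m [w [nw ->]]]] := classical_presentation cP; first by right.
  have [w1 [nw1 s1 g1]] := fifo_companion nw.
  exists (word_part k w1); split.
    split; last exact: similar_stats nw nw1 s1.
    by split; [exact: word_part_classical|exact: fifo_nonnesting nw1 g1].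
  (* Uniqueness: the word of a competitor is a queue word similar to [w1], hence equal to it. *)
  move=> P2 [[cP2 nn2]]; have [|k2 [m2 [w2 [nw2 e2]]]] := classical_presentation cP2.
    by left.
  rewrite e2 in nn2 *; move=> /(stats_similar nw nw2)[ek s2]; subst k2.
  have s12 := similar_trans (similar_sym s1) s2.
  by have /funext -> := greedy_unique s12 g1 (nonnesting_fifo nw2 nn2).
- move=> P [cP nn]; have [|k [m [w [nw ->]]]] := classical_presentation cP; first by left.
  have [w1 [nw1 s1 g1]] := lifo_companion nw.
  exists (word_part k w1); split.
    split; last by apply/sym; exact: similar_stats nw nw1 s1.
    by split; [exact: word_part_classical|exact: lifo_noncrossing nw1 g1].
  move=> P2 [[cP2 nc2]]; have [|k2 [m2 [w2 [nw2 e2]]]] := classical_presentation cP2.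
    by right.
  rewrite e2 in nc2 *; move=> /sym /(stats_similar nw nw2)[ek s2]; subst k2.
  have s12 := similar_trans (similar_sym s1) s2.
  by have /funext -> := greedy_unique s12 g1 (noncrossing_lifo nw2 nc2).
move=> L L' cL cL' [_ nc] [_ nn] st.
(* The subspaces are solution sets of two words with equal multiplicities, so a permutation of
   coordinates without sign changes carries one to the other. *)
have [k [m [w [nw e]]]] := subspace_presentation (or_intror nc).
have [k' [m' [w' [nw' e']]]] := subspace_presentation (or_introl nn).
rewrite /Part (eq_epart e) (eq_epart e') in st.
have [ek [cnt _ _]] := stats_similar nw nw' st; subst k'.
have [sigma ws] := equinumerous_perm cnt.
have ws' i : w i = w' ((sigma^-1)%g i) by rewrite ws permKV.
have sol (L0 : set 'rV[R]_n) (w0 : 'I_n -> nat) : classical_subspace L0 ->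
    coord_rel L0 =2 level_rel k w0 -> L0 = solutions (level_rel k w0).
  move=> cL0 e0; have <- : coord_rel L0 = level_rel k w0.
    by apply/funext => s; apply/funext => t.
  exact: classical_subspaceE.
rewrite (sol L w) // (sol L' w') //; apply/seteqP; split.
  by rewrite (solutions_perm _ _ ws'); apply: subspace_type_sub.
by rewrite (solutions_perm _ _ ws); apply: subspace_type_sub.
Qed.
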